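(* Let $K$ be a field of characteristic zero and let $I$ be a homogeneous zero-dimensional Gorenstein ideal of $R=K[x_1,\ldots,x_d]$. Let $f(z)=\sum_{n\geq0}a_nz^n\in K[[z]]$ be a formal power series with all coefficients $a_n$ non-zero, and let $t_1,\ldots,t_d$ be indeterminates. Then $$I=\left\{g\in K[x_1,\ldots,x_d] : g\left(\tfrac{\partial}{\partial t_1},\ldots,\tfrac{\partial}{\partial t_d}\right)f(t_1\overline{x}_1+\cdots+t_d\overline{x}_d)=0\right\},$$ where $f(t_1\overline{x}_1+\cdots+t_d\overline{x}_d)$ is regarded as an element of $K[t_1,\ldots,t_d]\otimes_K R/I$.
   Context: $\overline{x}_i$ is the class of $x_i$ in $R/I$. Zero-dimensional means $R/I$ is finite-dimensional over $K$; Gorenstein means $R/I$ is a Gorenstein ring, equivalently here $(I:\mathfrak{m})/I$ is one-dimensional over $K$ with $\mathfrak{m}=(x_1,\ldots,x_d)$. Since $I$ is homogeneous and zero-dimensional, $R/I$ is graded and $(t_1\overline{x}_1+\cdots+t_d\overline{x}_d)^n=0$ in $K[t_1,\ldots,t_d]\otimes_K R/I$ for all large $n$, so $f(t_1\overline{x}_1+\cdots+t_d\overline{x}_d)=\sum_n a_n(t_1\overline{x}_1+\cdots+t_d\overline{x}_d)^n$ is a finite sum. The operators $\partial/\partial t_i$ act $R/I$-linearly on $K[t_1,\ldots,t_d]\otimes_K R/I$. *)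

(* Defs.v *)
From HB Require Import structures.
From mathcomp Require Import all_boot all_order all_algebra.
From mathcomp Require Import generic_quotient ring_quotient.
From mathcomp.multinomials Require Import mpoly.
From Stdlib Require Import ClassicalEpsilon.

Set Implicit Arguments.
Unset Strict Implicit.
Unset Printing Implicit Defensive.

Import GRing.Theory.

Local Open Scope ring_scope.
Local Open Scope quotient_scope.

Section QuotientAlgebra.

Variables (K : comNzRingType) (R : comAlgType K) (I : idealr R).

Definition quot_scale (c : K) (x : {ideal_quot I}) : {ideal_quot I} :=
  \pi_{ideal_quot I} (c *: (1 : R)) * x.

Fact quot_scaleA c1 c2 x :
  quot_scale c1 (quot_scale c2 x) = quot_scale (c1 * c2) x.
Proof.
by rewrite /quot_scale mulrA -rmorphM /= -scalerAl mul1r scalerA.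
Qed.

Fact quot_scale1 : left_id 1 quot_scale.
Proof. by move=> x; rewrite /quot_scale scale1r rmorph1 mul1r. Qed.

Fact quot_scaleDr : right_distributive quot_scale +%R.
Proof. by move=> c x y; rewrite /quot_scale mulrDr. Qed.

Fact quot_scaleDl x : {morph quot_scale^~ x : c1 c2 / c1 + c2}.
Proof. by move=> c1 c2; rewrite /quot_scale scalerDl rmorphD /= mulrDl. Qed.

HB.instance Definition _ := GRing.Zmodule_isLmodule.Build K {ideal_quot I}
  quot_scaleA quot_scale1 quot_scaleDr quot_scaleDl.

Fact quot_scaleAl (c : K) (x y : {ideal_quot I}) :
  c *: (x * y) = (c *: x) * y.
Proof. exact: mulrA. Qed.

HB.instance Definition _ :=
  GRing.Lmodule_isLalgebra.Build K {ideal_quot I} quot_scaleAl.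

HB.instance Definition _ :=
  GRing.Lalgebra_isComAlgebra.Build K {ideal_quot I}.

Lemma quot_piZ (c : K) (p : R) :
  \pi_{ideal_quot I} (c *: p) = c *: \pi_{ideal_quot I} p.
Proof.
rewrite [RHS]/GRing.scale /= /quot_scale -[in LHS](mul1r p) scalerAl.
by rewrite rmorphM.
Qed.

End QuotientAlgebra.

Section Ideals.

Variables (K : fieldType) (d : nat).

Local Notation R := {mpoly K[d]}.

Definition homogeneous_ideal (I : idealr R) : Prop :=
  forall (g : R) (k : nat),
    g \in I -> pihomog [measure of mdeg] k g \in I.

Definition zero_dimensional (I : idealr R) : Prop :=
  exists (n : nat) (b : 'I_n -> {ideal_quot I}),
    forall x, exists c : 'I_n -> K, x = \sum_i c i *: b i.

Definition in_irrelevant_ideal (q : R) : Prop :=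
  exists h : 'I_d -> R, q = \sum_i h i * 'X_i.

Definition in_colon (I : idealr R) (J : R -> Prop) (p : R) : Prop :=
  forall q, J q -> p * q \in I.

Definition in_socle (I : idealr R) (x : {ideal_quot I}) : Prop :=
  exists2 p, in_colon I in_irrelevant_ideal p & x = \pi_{ideal_quot I} p.

(* Gorenstein condition for a homogeneous zero-dimensional ideal: the socle
   (I : m) / I has dimension exactly one over K. This forces I to be proper,
   so that taking I in idealr (proper ideals) excludes nothing. *)
Definition gorenstein (I : idealr R) : Prop :=
  exists2 s : {ideal_quot I}, s != 0 &
    forall x, in_socle x <-> exists c : K, x = c *: s.

End Ideals.

Section Nilpotent.

Variables (A : pzRingType) (u : A).

(* Junk value 0 when u is not nilpotent. *)
Definition nil_index : nat :=
  match excluded_middle_informative (exists n, u ^+ n == 0) with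
  | left h => ex_minn h
  | right _ => 0
  end.

Lemma nil_index_exp n : u ^+ n = 0 -> u ^+ nil_index = 0.
Proof.
rewrite /nil_index => un0.
case: excluded_middle_informative => [h|[]]; last by exists n; apply/eqP.
by case: ex_minnP => m /eqP.
Qed.

Lemma nil_index_le n : u ^+ n = 0 -> (nil_index <= n)%N.
Proof.
rewrite /nil_index => un0; case: excluded_middle_informative => // h.
by case: ex_minnP => m _; apply; apply/eqP.
Qed.

End Nilpotent.

Section Operators.

Variables (K : fieldType) (d : nat) (A : comAlgType K).

(* {mpoly A[d]} plays the role of K[t_1, ..., t_d] (x)_K A; the indeterminate
   t_i is 'X_i, and c%:A is the image in A of the scalar c : K. *)

(* The value at a nilpotent u of the power series with coefficients a; see
   fps_eval_nilE for the independence of the truncation. *)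
Definition fps_eval (a : nat -> K) (u : {mpoly A[d]}) : {mpoly A[d]} :=
  \sum_(n < nil_index u) (a n)%:A *: u ^+ n.

Lemma fps_eval_nilE a (u : {mpoly A[d]}) n :
  u ^+ n = 0 -> fps_eval a u = \sum_(k < n) (a k)%:A *: u ^+ k.
Proof.
move=> un0; have u0 := nil_index_exp un0.
rewrite /fps_eval (big_ord_widen _ (fun k => (a k)%:A *: u ^+ k)
  (nil_index_le un0)) big_mkcond /=.
apply: eq_bigr => k _; case: ltnP => // le_uk.
by rewrite -(subnK le_uk) exprD u0 mulr0 scaler0.
Qed.

(* g(d/dt_1, ..., d/dt_d) applied to F. *)
Definition diffop (g : {mpoly K[d]}) (F : {mpoly A[d]}) : {mpoly A[d]} :=
  \sum_(m <- msupp g) (g@_m)%:A *: mderivm m F.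

End Operators.

Section GenericForm.

Variables (K : fieldType) (d : nat) (I : idealr {mpoly K[d]}).

Definition generic_linear_form : {mpoly {ideal_quot I}[d]} :=
  \sum_(i < d) (\pi_{ideal_quot I} ('X_i : {mpoly K[d]})) *: 'X_i.

Hypothesis homI : homogeneous_ideal I.
Hypothesis zdI : zero_dimensional I.

Let xb i : {ideal_quot I} := \pi_{ideal_quot I} ('X_i : {mpoly K[d]}).

Lemma quot_pi_eq0 (p : {mpoly K[d]}) :
  (\pi_{ideal_quot I} p == 0) = (p \in I).
Proof. by rewrite -[p in RHS]subr0 Quotient.idealrBE rmorph0. Qed.

Lemma var_class_nilpotent i : exists k, xb i ^+ k = 0.
Proof.
have [n [b bP]] := zdI.
have /fin_all_exists [c cP] : forall j : 'I_n.+1,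
  exists c : 'rV[K]_n, xb i ^+ j = \sum_l c 0 l *: b l.
  move=> j; have [c ->] := bP (xb i ^+ j).
  by exists (\row_l c l); apply: eq_bigr => l _; rewrite mxE.
pose C := \matrix_(j < n.+1) c j.
have kerC : kermx C != 0.
  rewrite -mxrank_eq0 mxrank_ker subn_eq0 -ltnNge ltnS.
  exact: rank_leq_col.
have /rowV0Pn [v /sub_kermxP vC v0] := kerC.
have [j vj] : exists j, v 0 j != 0 by apply/rV0Pn.
pose p : {mpoly K[d]} := \sum_(l < n.+1) v 0 l *: 'X_i ^+ l.
have pI : p \in I.
  rewrite -quot_pi_eq0 /p rmorph_sum /=; apply/eqP.
  transitivity (\sum_(l < n) (v *m C) 0 l *: b l); last first.
    by rewrite vC big1 // => l _; rewrite mxE scale0r.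
  under eq_bigr => l _.
    by rewrite quot_piZ rmorphXn /= cP scaler_sumr; over.
  rewrite exchange_big /=; apply: eq_bigr => l _.
  rewrite mxE scaler_suml; apply: eq_bigr => l' _.
  by rewrite scalerA mxE.
exists j; have := homI j pI.
suff -> : pihomog [measure of mdeg] j p = v 0 j *: 'X_i ^+ j.
  move=> hI; apply/eqP; rewrite -rmorphXn quot_pi_eq0.
  by rewrite -['X_i ^+ j](scalerK vj) -mul_mpolyC idealMr.
rewrite /p raddf_sum (bigD1 j) //= big1 ?addr0 => [|l lj].
  by rewrite linearZ /= mpolyXn pihomogX /= mdegMn mdeg1 mul1n eqxx.
rewrite linearZ /= mpolyXn pihomogX /= mdegMn mdeg1 mul1n.
by rewrite val_eqE (negPf lj) scaler0.
Qed.

(* Hence nil_index, and so fps_eval, has no junk value at this element. *)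
Lemma generic_linear_form_nilpotent : exists n, generic_linear_form ^+ n = 0.
Proof.
rewrite /generic_linear_form.
apply: (big_ind (fun u : {mpoly {ideal_quot I}[d]} => exists n, u ^+ n = 0)).
- by exists 1%N; rewrite expr1.
- move=> u v [m um] [n vn]; exists (m + n)%N; rewrite exprDn big1 // => k _.
  have [le_nk|lt_kn] := leqP n k.
    by rewrite -(subnK le_nk) exprD vn !mulr0 mul0rn.
  have le_m : (m <= m + n - k)%N by rewrite -addnBA ?leq_addr // ltnW.
  by rewrite -(subnK le_m) exprD um mulr0 mul0r mul0rn.
- move=> i _; have [k xk] := var_class_nilpotent i.
  by exists k; rewrite exprZn xk scale0r.
Qed.

End GenericForm.

(* Main.v *)
(* With l the generic linear form, d/dt_i l = (class of x_i), so a form p of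
   degree k satisfies p(d/dt) l^n = n(n-1)...(n-k+1) (class of p) l^(n-k).
   If g lies in I, so do its homogeneous components g_k, and each g_k(d/dt)
   kills every power of l.  Conversely, setting t = 0 in g(d/dt) f(l) = 0 gives
   sum_k k! a_k g_k in I, and homogeneity puts every g_k in I. *)
Require Import Defs.
From mathcomp Require Import all_boot all_order all_algebra.
From mathcomp Require Import generic_quotient ring_quotient.
From mathcomp.multinomials Require Import mpoly.

Import GRing.Theory.

Set Implicit Arguments.
Unset Strict Implicit.
Unset Printing Implicit Defensive.

Local Open Scope ring_scope.
Local Open Scope quotient_scope.

Lemma mderivX_expn (d : nat) (A : comNzRingType) (i : 'I_d) (p : {mpoly A[d]}) n :
  mderiv i (p ^+ n) = (p ^+ n.-1 * mderiv i p) *+ n.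
Proof.
elim: n => [|n IHn]; first by rewrite expr0 -mpolyC1 mderivC.
rewrite exprS mderivM IHn mulrnAr mulrA mulrC mulrS /=.
(* The split on [n] is for [n.-1]: at zero the truncated exponent sits in a zero multiple. *)
by case: n {IHn} => [|n] /=; rewrite ?mulr0n // exprS.
Qed.

Section GenericLinearForm.

Variables (K : fieldType) (d : nat) (I : idealr {mpoly K[d]}).

Local Notation Q := {ideal_quot I}.
Local Notation l := (generic_linear_form I).

Lemma mderiv_generic_linear_form i :
  mderiv i l = (\pi_Q ('X_i : {mpoly K[d]}))%:MP.
Proof.
rewrite /generic_linear_form raddf_sum (bigD1 i) //= big1 ?addr0 => [|j ji].
  have UU : (U_(i) - U_(i) = 0)%MM by apply/mnmP=> j; rewrite mnmBE subnn mnm0E.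
  by rewrite mderivZ mderivX mnm1E eqxx scale1r UU mpolyX0 alg_mpolyC.
by rewrite mderivZ mderivX mnm1E (negPf ji) scale0r scaler0.
Qed.

(** When [mdeg m] exceeds [n], the falling factorial is zero, so the truncated exponent [n - mdeg m]
    is harmless. *)
Lemma mderivm_generic_linear_form_exp m n :
  mderivm m (l ^+ n) =
    (\pi_Q ('X_[m] : {mpoly K[d]}) *+ n ^_ (mdeg m)) *: l ^+ (n - mdeg m).
Proof.
(* Induction on the degree of [m], splitting off one [U_(i)] with [m i] nonzero at each step. *)
move: {2}(mdeg m) (erefl (mdeg m)) => k.
elim: k m => [|k IHk] m mk.
  have /eqP -> : m == 0%MM by rewrite -mdeg_eq0 mk.
  by rewrite mderivm0m mdeg0 mpolyX0 rmorph1 scale1r subn0.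
have /existsP[i mi] : [exists i, m i != 0%N].
  apply: contra_eqT mk => /existsPn m0; suff -> : m = 0%MM by rewrite mdeg0.
  by apply/mnmP=> i; rewrite mnm0E; apply/eqP/negbNE.
have mE : m = (m - U_(i) + U_(i))%MM by rewrite submK // lep1mP.
have {}mk : mdeg (m - U_(i))%MM = k.
  by move: mk; rewrite {1}mE mdegD mdeg1 addn1 => -[].
rewrite mE mderivmDm mderivmU1m IHk // mderivZ mderivX_expn.
rewrite mderiv_generic_linear_form mulrC mul_mpolyC.
have -> : mdeg (m - U_(i) + U_(i))%MM = k.+1 by rewrite mdegD mdeg1 mk addn1.
have -> : \pi_Q ('X_[m - U_(i) + U_(i)] : {mpoly K[d]}) =
    \pi_Q ('X_[m - U_(i)] : {mpoly K[d]}) * \pi_Q ('X_i : {mpoly K[d]}).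
  by rewrite mpolyXD rmorphM.
by rewrite mk ffactnSr subnS scalerMnl scalerA mulrnAr mulrnAl -mulrnA.
Qed.

Lemma generic_linear_form_const : l@_0%MM = 0.
Proof.
rewrite /generic_linear_form raddf_sum big1 // => i _ /=.
by rewrite mcoeffZ mcoeffX mnm1_eq0 mulr0.
Qed.

Lemma diffop_generic_linear_form_exp g n :
  diffop g (l ^+ n) =
    \sum_(k < n.+1) (\pi_Q (pihomog mdeg k g) *+ n ^_ k) *: l ^+ (n - k).
Proof.
under eq_bigr => k _.
  rewrite pihomogE raddf_sum /= -sumrMnl scaler_suml; over.
rewrite /= (exchange_big_dep predT) //= /diffop; apply: eq_bigr => m _.
rewrite mderivm_generic_linear_form_exp scalerA.
(* The monomial [m] occurs only in the component [k = mdeg m]. If this exceeds [n], no index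
   matches, and the falling factorial vanishes as well. *)
have [le_mn|lt_nm] := leqP (mdeg m) n; last first.
  rewrite ffact_small // mulr0n mulr0 scale0r big1 // => k /eqP mk.
  by move: lt_nm; rewrite mk ltnNge -ltnS ltn_ord.
rewrite (big_pred1 (Ordinal (le_mn : (mdeg m < n.+1)%N))) => [|k]; last first.
  by rewrite [RHS]eq_sym -val_eqE.
by rewrite /= quot_piZ mulrnAr mulr_algl.
Qed.

(** Any vanishing power may serve as truncation, so [N] can later be taken beyond the degree of
    [g]. *)
Lemma diffop_fps_eval_generic_linear_form (a : nat -> K) g N :
    l ^+ N = 0 ->
  diffop g (fps_eval a l) = \sum_(n < N) (a n)%:A *: diffop g (l ^+ n).
Proof.
move=> lN; rewrite (fps_eval_nilE _ lN) /diffop.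
under eq_bigr => m _ do rewrite raddf_sum scaler_sumr.
rewrite exchange_big; apply: eq_bigr => n _ /=.
rewrite scaler_sumr; apply: eq_bigr => m _.
by rewrite mderivmZ !scalerA mulrC.
Qed.

(** Since [l] has no constant term, only [k = n] survives, with [n ^_ n = n!]. *)
Lemma mcoeff0_diffop_generic_linear_form_exp g n :
  (diffop g (l ^+ n))@_0%MM = \pi_Q (pihomog mdeg n g) *+ n`!.
Proof.
rewrite diffop_generic_linear_form_exp raddf_sum big_ord_recr /=.
rewrite subnn expr0 mcoeffZ mcoeff1 eqxx mulr1 ffactnn big1 ?add0r // => k _.
rewrite mcoeffZ rmorphXn /= generic_linear_form_const expr0n subn_eq0.
by rewrite leqNgt ltn_ord mulr0.
Qed.

End GenericLinearForm.

Theorem proposition7p2 (K : fieldType) (charK : [pchar K] =i pred0) (d : nat)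
    (I : idealr {mpoly K[d]})
    (homI : homogeneous_ideal I) (zdI : zero_dimensional I)
    (gorI : gorenstein I)
    (a : nat -> K) (a_neq0 : forall n, a n != 0) :
  forall g : {mpoly K[d]},
    g \in I <-> diffop g (fps_eval a (generic_linear_form I)) = 0.
Proof.
move=> g.
have [N0 lN0] := generic_linear_form_nilpotent homI zdI.
(* [N0] makes the power of the form vanish; [msize g] ensures that every homogeneous component of
   [g] has index below [N]. *)
pose N := (N0 + msize g)%N.
have lN : generic_linear_form I ^+ N = 0 by rewrite exprD lN0 mul0r.
rewrite (diffop_fps_eval_generic_linear_form _ _ lN).
split=> [gI|].
  rewrite big1 // => n _; rewrite diffop_generic_linear_form_exp big1 ?scaler0 //.
  move=> k _; have /eqP -> : \pi_{ideal_quot I} (pihomog mdeg k g) == 0.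
    by rewrite quot_pi_eq0; apply: homI.
  by rewrite mul0rn scale0r.
move=> /(congr1 (mcoeff 0%MM)); rewrite mcoeff0 raddf_sum /=.
under eq_bigr => n _ do
  rewrite mcoeffZ mcoeff0_diffop_generic_linear_form_exp mulr_algl.
set h := fun n => (a n * n`!%:R) *: pihomog mdeg n g.
have -> : \sum_(n < N) a n *: (\pi_{ideal_quot I} (pihomog mdeg n g) *+ n`!)
          = \pi_{ideal_quot I} (\sum_(n < N) h n).
  rewrite raddf_sum; apply: eq_bigr => n _ /=.
  by rewrite quot_piZ -scalerA scaler_nat.
move=> /eqP; rewrite quot_pi_eq0 => hI.
have gE : g = \sum_(n < N) pihomog mdeg n g.
  by apply: pihomog_partitionE; rewrite leq_addl.
rewrite gE; apply: rpred_sum => n _.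
(* The degree [n] component of the sum is [h n] alone, the other summands being forms of other
   degrees. *)
have := homI _ n hI; rewrite raddf_sum (bigD1 n) //= big1 ?addr0; last first.
  by move=> k kn; rewrite linearZ /= (pihomog_ne0 _ (pihomogP _ _ _)) ?scaler0.
rewrite linearZ /= pihomog_id => hn.
(* Characteristic zero keeps [n!] nonzero in [K], so the scalar can be divided out. *)
have c0 : a n * n`!%:R != 0.
  by rewrite mulf_neq0 // (iffLR (pcharf0P _)) // -lt0n fact_gt0.
by rewrite -[pihomog _ _ _](scalerK c0) -mul_mpolyC idealMr.
Qed.
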